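(* Let $\Delta$ be a simplicial complex on $[n]=\{1,\ldots,n\}$ of dimension at least $1$ such that $\{v\}\in\Delta$ for all $v\in[n]$. If $\Delta$ is a matroid, then there exists an integer $p\ge2$ such that the $1$-skeleton of $\Delta$ is a complete $p$-partite graph.
   Context: A simplicial complex $\Delta$ is a matroid if for any $F,G\in\Delta$ with $|F|<|G|$ there is $i\in G\setminus F$ with $F\cup\{i\}\in\Delta$. The dimension of $\Delta$ is $\max\{|F|-1 : F\in\Delta\}$. The $1$-skeleton of $\Delta$ is the simplicial complex whose facets are the two-element faces of $\Delta$, viewed as a graph on $[n]$. A graph is complete $p$-partite if its vertex set can be partitioned into $p$ disjoint nonempty sets $A_1,\ldots,A_p$ such that $\{v,w\}$ is an edge if and only if $v$ and $w$ lie in different sets of the partition. *)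

(* Defs.v *)
From mathcomp Require Import all_boot all_order all_algebra.

Set Implicit Arguments.
Unset Strict Implicit.
Unset Printing Implicit Defensive.

Section Complexes.
Variable T : finType.
Implicit Types D : {set {set T}}.

Definition simplicial_complex D : Prop :=
  D != set0 /\
  forall F G : {set T}, F \in D -> G \subset F -> G \in D.

(* A property of simplicial complexes: closure under subsets is not repeated. *)
Definition matroid D : Prop :=
  forall F G : {set T}, F \in D -> G \in D -> #|F| < #|G| ->
    exists2 i, i \in G :\: F & i |: F \in D.

(* The dimension is an integer, as that of the complex [set set0] is -1; the
   default value -1 of the maximum is harmless since #|F| - 1 >= -1. *)
Definition dimension D : int :=
  \big[Num.max/(-1)%R]_(F in D) (#|F|%:Z - 1)%R.

(* The complex with the two-element faces of D as facets: it consists of all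
   the subsets of these faces. *)
Definition one_skeleton D : {set {set T}} :=
  [set H : {set T} | [exists F in D, (#|F| == 2) && (H \subset F)]].

(* The inequality excludes loops, as [set v; v] is the singleton [set v]. *)
Definition complex_graph D : rel T :=
  fun v w => (v != w) && ([set v; w] \in D).

Definition complete_partite (p : nat) (e : rel T) : Prop :=
  exists P : {set {set T}},
    [/\ partition P [set: T],
        #|P| = p
      & forall v w : T, e v w <-> pblock P v != pblock P w].

End Complexes.

(* Main.v *)
(* By the exchange property applied to a vertex v and an edge {u, w}, one of
   {u, v}, {v, w} is an edge: so non-adjacency is an equivalence relation, and
   its classes are the parts. *)
Require Import Defs.
From mathcomp Require Import all_boot all_order all_algebra.

Set Implicit Arguments.
Unset Strict Implicit.
Unset Printing Implicit Defensive.

Import Order.TTheory.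

Section GraphOfComplex.
Variable T : finType.
Implicit Types D : {set {set T}}.

(** Non-adjacency is reflexive and symmetric by definition; in a matroid it is also transitive, by
    [matroid_edge_exchange] read contrapositively. Its classes are then the parts
    ([complete_partiteP]), and a face of positive dimension supplies an edge ([dimension_ge1_edge]),
    which forces at least two of them. *)

Lemma complex_graph_one_skeleton D (v w : T) :
  complex_graph (one_skeleton D) v w = complex_graph D v w.
Proof.
rewrite /complex_graph; case: (eqVneq v w) => //= neq_vw.
have card_vw : #|[set v; w]| = 2 by rewrite cards2 neq_vw.
rewrite inE; apply/existsP/idP => [[F /and3P[FD /eqP cardF sub]]|vwD].
  suff -> : [set v; w] = F by [].
  by apply/eqP; rewrite eqEcard sub cardF card_vw.
by exists [set v; w]; rewrite vwD card_vw eqxx subxx.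
Qed.

Lemma dimension_ge1_edge D : simplicial_complex D -> (1 <= dimension D)%R ->
  exists v w : T, complex_graph D v w.
Proof.
move=> [_ closedD] dimD.
have [/existsP[F /andP[FD /card_gt1P[v [w [vF wF neq_vw]]]]]|noF] :=
    boolP [exists F in D, 1 < #|F|].
  exists v, w; rewrite /complex_graph neq_vw.
  by apply: closedD FD _; rewrite subUset !sub1set vF.
suff : (dimension D < 1)%R by rewrite ltNge dimD.
(* The default [-1] is below [1], so it remains to bound each face: at most one vertex gives
   [#|F| - 1 <= 0]. *)
apply: bigmax_lt => // F FD.
move: noF; rewrite negb_exists => /forallP/(_ F).
by rewrite FD /= -leqNgt; case: #|F| => [|[]].
Qed.

Lemma complex_graph_sym D : symmetric (complex_graph D).
Proof. by move=> v w; rewrite /complex_graph eq_sym setUC. Qed.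

(** Exchange adds to [[set v]] an endpoint of the edge, and picks it outside [[set v]]; hence no
    loop arises, even when [v] is [u] or [w]. *)
Lemma matroid_edge_exchange D (u v w : T) :
    matroid D -> [set v] \in D -> complex_graph D u w ->
  complex_graph D u v || complex_graph D v w.
Proof.
move=> matD vD /andP[neq_uw uwD].
have [|i] := matD [set v] [set u; w] vD uwD; first by rewrite cards1 cards2 neq_uw.
rewrite !inE => /andP[neq_iv /orP[]/eqP eq_i] ivD; rewrite {}eq_i in neq_iv ivD.
  by rewrite /complex_graph neq_iv ivD.
by rewrite (complex_graph_sym D v) /complex_graph neq_iv ivD orbT.
Qed.

(** The parts are the classes of non-adjacency; the two ends of an edge lie in different classes,
    whence [2 <= p]. *)
Lemma complete_partiteP (e : rel T) :
    equivalence_rel (fun v w => ~~ e v w) -> (exists v w, e v w) ->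
  exists p : nat, 2 <= p /\ complete_partite p e.
Proof.
move=> eqv_e [a [b e_ab]].
have eqv_in : {in [set: T] & &, equivalence_rel (fun v w => ~~ e v w)}.
  by move=> x y z _ _ _; apply: eqv_e.
set P := equivalence_partition (fun v w => ~~ e v w) [set: T].
have partP : partition P [set: T] := equivalence_partitionP eqv_in.
have /and3P[/eqP coverP trivP _] := partP.
have eP v w : e v w = (pblock P v != pblock P w).
  by rewrite eq_pblock ?coverP ?inE // pblock_equivalence_partition ?inE // negbK.
exists #|P|; split; last by exists P; split=> // v w; rewrite eP.
apply/card_gt1P; exists (pblock P a), (pblock P b).
by rewrite !pblock_mem ?coverP ?inE // -eP.
Qed.

End GraphOfComplex.

Theorem corollary2p3 (n : nat) (D : {set {set 'I_n}})
    (complexD : simplicial_complex D)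
    (dimD : (1 <= dimension D)%R)
    (vertexD : forall v : 'I_n, [set v] \in D) :
  matroid D ->
  exists p : nat, 2 <= p /\ complete_partite p (complex_graph (one_skeleton D)).
Proof.
move=> matD; apply: complete_partiteP; last first.
  have [v [w e_vw]] := dimension_ge1_edge complexD dimD.
  by exists v, w; rewrite complex_graph_one_skeleton.
have trans u v w : ~~ complex_graph D u v -> ~~ complex_graph D v w ->
    ~~ complex_graph D u w.
  move=> nuv nvw; apply/negP => /(matroid_edge_exchange matD (vertexD v)).
  by rewrite (negPf nuv) (negPf nvw).
move=> x y z; rewrite !complex_graph_one_skeleton; split.
  by rewrite /complex_graph eqxx.
(* [equivalence_rel] asks for an equality of booleans: each direction is an instance of [trans], one
   of them with [nxy] reversed. *)
move=> nxy; apply/idP/idP; apply: trans => //.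
by rewrite complex_graph_sym.
Qed.
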